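(* Let $E$ be a nonzero real Banach space and $S\colon E\rightrightarrows E^*$ be closed, monotone and quasidense. Then $S$ is maximally monotone of type (FPV).
   Context: For a multifunction $S\colon E\rightrightarrows E^*$ with nonempty graph $G(S)$ and domain $D(S)$: closed means $G(S)$ norm-closed in $E\times E^*$; monotone means $\langle s-t,s^*-t^*\rangle\ge0$ for all $(s,s^* ),(t,t^* )\in G(S)$; quasidense means for every $(x,x^* )\in E\times E^*$, $\inf_{(s,s^* )\in G(S)}[\tfrac12\|s-x\|^2+\tfrac12\|s^*-x^*\|^2+\langle s-x,s^*-x^*\rangle]\le0$. A monotone $S$ is of type (FPV) if whenever $U$ is an open convex subset of $E$ with $U\cap D(S)\ne\emptyset$, $(w,w^* )\in U\times E^*$, and $\langle s-w,s^*-w^*\rangle\ge0$ for all $(s,s^* )\in G(S)$ with $s\in U$, then $(w,w^* )\in G(S)$. *)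

(* Defs.v *)
From HB Require Import structures.
From mathcomp Require Import all_boot all_order all_algebra.
From mathcomp Require Import all_classical all_reals all_analysis.
Set Implicit Arguments. Unset Strict Implicit. Unset Printing Implicit Defensive.
Import Order.TTheory GRing.Theory Num.Theory.
Import numFieldNormedType.Exports.
Local Open Scope classical_set_scope.
Local Open Scope ring_scope.

Section Monotone.
Variables (R : realType) (E : normedModType R).

Definition is_dual (f : E -> R) : Prop :=
  (forall (a : R) (x y : E), f (a *: x + y) = a * f x + f y) /\ continuous f.

Definition dnorm (f : E -> R) : R :=
  sup [set `|f x| | x in [set x : E | `|x| <= 1]].

Definition graph (S : E -> set (E -> R)) : set (E * (E -> R)) :=
  [set p | S p.1 p.2].

Definition dom (S : E -> set (E -> R)) : set E :=
  [set x | exists xs, S x xs].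

Definition multifunction (S : E -> set (E -> R)) : Prop :=
  (exists p, graph S p) /\ (forall x xs, S x xs -> is_dual xs).

Definition closed_mf (S : E -> set (E -> R)) : Prop :=
  forall (x : E) (xs : E -> R), is_dual xs ->
    (forall eps : R, 0 < eps -> exists s ss, S s ss /\
        `|s - x| < eps /\ dnorm (fun y => ss y - xs y) < eps) ->
    S x xs.

Definition monotone_mf (S : E -> set (E -> R)) : Prop :=
  forall s ss t ts, S s ss -> S t ts -> 0 <= ss (s - t) - ts (s - t).

Definition quasidense (S : E -> set (E -> R)) : Prop :=
  forall (x : E) (xs : E -> R), is_dual xs ->
    (ereal_inf [set r : \bar R | exists (s : E) (ss : E -> R), S s ss /\
        r = (2^-1 * `|s - x| ^+ 2
             + 2^-1 * dnorm (fun y => ss y - xs y) ^+ 2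
             + (ss (s - x) - xs (s - x)))%:E] <= 0)%E.

Definition maximally_monotone (S : E -> set (E -> R)) : Prop :=
  monotone_mf S /\
  forall (w : E) (ws : E -> R), is_dual ws ->
    (forall s ss, S s ss -> 0 <= ss (s - w) - ws (s - w)) -> S w ws.

Definition convex_set (U : set E) : Prop :=
  forall x y (t : R), U x -> U y -> 0 <= t -> t <= 1 ->
    U (t *: x + (1 - t) *: y).

Definition type_FPV (S : E -> set (E -> R)) : Prop :=
  monotone_mf S /\
  forall (U : set E), open U -> convex_set U -> U `&` dom S !=set0 ->
  forall (w : E) (ws : E -> R), U w -> is_dual ws ->
    (forall s ss, S s ss -> U s -> 0 <= ss (s - w) - ws (s - w)) -> S w ws.

End Monotone.

(* Main.v *)
(* Write q(x, x* ) = <x, x*> on E x E* and g_l(x, x* ) = |x|^2 / (2 l) + l |x*|^2 / 2.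
   Quasidensity says that inf (g_1 + q)(s - v) <= 0 over s in G(S), for every v. The key
   point is that g_1 may be replaced by g_l for every l > 0. To see this at v = 0, let
   phi >= q be the Fitzpatrick function of S. If inf (phi + g_l) were positive, Hahn-Banach
   would separate phi from - g_l by a functional (a, b) in E* x E**, and quasidensity at
   points (0, a + v) with v almost norming b excludes this. A point where phi + g_l is
   small is almost monotonically related to S, so quasidensity puts a point of G(S) near it.

   For type (FPV), translate so that (w, w* ) = (0, 0). The points s = s_l given by the
   scaled quasidensity at (y, 0) are approximate resolvents: as l -> 0 their distance to y
   tends to dist(y, D(S)), while <s - y, s*> is at most about - |s - y|^2 / (2 l). Taking y
   just outside the closure of D(S) on the segment from 0 to a point of D(S) in U would give
   s in U with <s, s*> < 0; hence 0 is in the closure of D(S). Taking then y = 0 gives s in U,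
   so <s, s*> >= 0, whence (s, s* ) is as close to (0, 0) as desired, and S is closed.
   Maximality is the case U = E. *)
Require Import Defs.
From HB Require Import structures.
From mathcomp Require Import all_boot all_order all_algebra.
From mathcomp Require Import all_classical all_reals all_analysis.
From mathcomp Require Import ring lra.
Import Order.TTheory GRing.Theory Num.Theory.
Import numFieldNormedType.Exports.
Local Open Scope classical_set_scope.
Local Open Scope ring_scope.

(** * Hahn-Banach through maximal cones *)

Section ConeSeparation.
Variables (R : realType) (V : lmodType R).
Implicit Types (K : set (V * R)) (u v : V) (r s t a b : R).

(** Such a cone plays the part of the epigraph of a sublinear function; the last condition excludes
    negative values at 0. *)
Definition proper_cone K :=
  [/\ K (0, 0),
      forall u r v s, K (u, r) -> K (v, s) -> K (u + v, r + s),
      forall t u r, 0 < t -> K (u, r) -> K (t *: u, t * r) &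
      forall r, K (0, r) -> 0 <= r].

(** Zorn's lemma is applied to the sets whose union with [K0] is proper, rather than to the proper
    cones containing [K0], because the union of the empty chain is empty. *)
Lemma maximal_proper_cone K0 : proper_cone K0 ->
  exists K, [/\ proper_cone K, K0 `<=` K &
    forall B, proper_cone B -> K `<=` B -> B = K].
Proof.
move=> pK0; pose P : set (set (V * R)) := fun A => proper_cone (K0 `|` A).
have [|A [PA maxA]] := @Zorn_bigcup _ P; last first.
  exists (K0 `|` A); split => // B pB KB.
  rewrite eqEsubset; split => //; apply/not_notP => nBK.
  apply: (maxA B).
    split; first by move=> x Ax; apply: KB; right.
    by move=> BA; apply: nBK => x Bx; right; apply: BA.
  rewrite /P; suff -> : K0 `|` B = B by [].
  by rewrite setUidr // => x K0x; apply: KB; left.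
move=> F FP totF; rewrite /P.
have [F0|/set0P[X0 FX0]] := eqVneq F set0.
  by rewrite F0 bigcup_set0 setU0.
have in_one x : (K0 `|` \bigcup_(X in F) X) x -> exists2 X, F X & (K0 `|` X) x.
  by case=> [K0x|[X FX Xx]]; [exists X0 => //; left|exists X => //; right].
have out X x : F X -> (K0 `|` X) x -> (K0 `|` \bigcup_(X in F) X) x.
  by move=> FX [K0x|Xx]; [left|right; exists X].
split.
- by left; case: pK0.
- move=> u r v s /in_one[X FX Xu] /in_one[Y FY Yv].
  have [XY|YX] := totF _ _ FX FY.
    apply: (out _ _ FY); case: (FP _ FY) => _ + _ _; apply => //.
    by case: Xu => ?; [left|right; apply: XY].
  apply: (out _ _ FX); case: (FP _ FX) => _ + _ _; apply => //.
  by case: Yv => ?; [left|right; apply: YX].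
- move=> t u r t0 /in_one[X FX Xu]; apply: (out _ _ FX).
  by case: (FP _ FX) => _ _ + _; apply.
- by move=> r /in_one[X FX Xr]; case: (FP _ FX) => _ _ _; apply.
Qed.

(** Adjoining the ray through [(v, r)] keeps the cone proper: a new element over 0 comes from some
    [(- (t *: v), s)] in [K], and rescaling by [t^-1] reduces its sign to the hypothesis. *)
Lemma maximal_proper_cone_add K v r : proper_cone K ->
  (forall B, proper_cone B -> K `<=` B -> B = K) ->
  (forall s, K (- v, s) -> 0 <= s + r) -> K (v, r).
Proof.
move=> [K00 KD KZ Kp] maxK vr.
pose B : set (V * R) := [set p | exists (t : R) u s,
  [/\ 0 <= t, K (u, s) & p = (u + t *: v, s + t * r)]].
have Bv : B (v, r) by exists 1, 0, 0; rewrite !add0r scale1r mul1r ler01.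
suff -> : K = B by [].
apply/esym/maxK; last first.
  by move=> [u s] Kus; exists 0, u, s; rewrite scale0r mul0r !addr0.
split.
- by exists 0, 0, 0; rewrite scale0r mul0r !addr0.
- move=> _ _ _ _ [t [u [s [t0 Ku [-> ->]]]]] [t' [u' [s' [t'0 Ku' [-> ->]]]]].
  exists (t + t'), (u + u'), (s + s'); split; rewrite ?addr_ge0 //; first exact: KD.
  by rewrite scalerDl mulrDl addrACA [X in (_, X)]addrACA.
- move=> a _ _ a0 [t [u [s [t0 Ku [-> ->]]]]].
  exists (a * t), (a *: u), (a * s); split; first by rewrite mulr_ge0 // ltW.
    exact: KZ.
  by rewrite scalerDr mulrDr scalerA mulrA.
- move=> _ [t [u [s [t0 Ku [+ ->]]]]] => /esym/eqP; rewrite addr_eq0 => /eqP uE.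
  move: t0; rewrite le_eqVlt => /orP[/eqP t0|t0].
    by rewrite -t0 mul0r addr0; apply: Kp; rewrite uE -t0 scale0r oppr0 in Ku.
  have ti0 : 0 < t^-1 by rewrite invr_gt0.
  have := KZ _ _ _ ti0 Ku; rewrite uE scalerN scalerA mulVf ?gt_eqF// scale1r.
  move=> /vr h; have := mulr_ge0 (ltW t0) h.
  by rewrite mulrDr mulrA divff ?gt_eqF// mul1r.
Qed.

(* A maximal proper cone contains exactly one line over each [v], and these lines
   form the graph of the functional. *)
Lemma linear_minorant K :
  (forall u r v s, K (u, r) -> K (v, s) -> K (u + v, r + s)) ->
  (forall t u r, 0 < t -> K (u, r) -> K (t *: u, t * r)) ->
  (forall r, K (0, r) -> 0 <= r) ->
  (forall v, exists r, K (v, r)) ->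
  exists f : V -> R, (forall a u v, f (a *: u + v) = a * f u + f v) /\
    forall u r, K (u, r) -> f u <= r.
Proof.
move=> KD KZ Kp Kdom.
have : proper_cone (K `|` [set (0, 0)]).
  split; first by right.
  - move=> u r v s [Ku|[-> ->]] [Kv|[-> ->]]; rewrite ?addr0 ?add0r;
      by [left; exact: KD|left|right].
  - move=> t u r t0 [Ku|[-> ->]]; first by left; exact: KZ.
    by right; rewrite scaler0 mulr0.
  - by move=> r [/Kp//|[->]].
move=> /maximal_proper_cone[M [pM KM maxM]].
have add := maximal_proper_cone_add M _ _ pM maxM.
have {}KM u r : K (u, r) -> M (u, r) by move=> ?; apply: KM; left.
case: pM => M0 MD MZ Mp.
have line v : exists a, M (v, a) /\ M (- v, - a).
  pose A := [set r | M (v, r)].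
  have lbA s : M (- v, s) -> lbound A (- s).
    move=> Ms r Mr; rewrite lerNl -subr_ge0 opprK; apply: Mp.
    by have := MD _ _ _ _ Ms Mr; rewrite addNr.
  have A0 : A !=set0 by have [r /KM] := Kdom v; exists r.
  have [s0 /KM Ms0] := Kdom (- v).
  have hA : has_inf A by split => //; exists (- s0); exact: lbA.
  (* [(v, inf A)] may be added because the values over [- v] bound [A] from below, and
     [(- v, - inf A)] because [inf A] is itself a lower bound of [A]. *)
  exists (inf A); split; apply: add => s.
    by move=> /lbA/lb_le_inf => /(_ A0); rewrite -subr_ge0 opprK addrC.
  rewrite opprK => Ms; rewrite subr_ge0; apply: ge_inf => //.
  by case: hA.
have uniqM v a b : M (v, a) -> M (- v, - b) -> b <= a.
  by move=> Ma Mb; rewrite -subr_ge0; apply: Mp; have := MD _ _ _ _ Ma Mb; rewrite subrr.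
have [f fP] := choice line; exists f; split => [a u v|u r /KM Kur]; last first.
  by have [_ fu] := fP u; exact: uniqM fu.
have scale : M (a *: u, a * f u) /\ M (- (a *: u), - (a * f u)).
  have [fu1 fu2] := fP u; have [a0|a0|->] := ltgtP a 0.
  - rewrite -oppr_gt0 in a0; have := MZ _ _ _ a0 fu1; have := MZ _ _ _ a0 fu2.
    by rewrite !scaleNr !mulNr !scalerN !mulrN !opprK.
  - by rewrite -scalerN -mulrN; split; exact: MZ.
  - by rewrite scale0r mul0r !oppr0.
have [fv1 fv2] := fP v; have [s1 s2] := scale; have [f1 f2] := fP (a *: u + v).
apply/eqP; rewrite eq_le; apply/andP; split.
  by apply: uniqM f2; exact: MD.
by apply: uniqM f1 _; rewrite !opprD; exact: MD.
Qed.

End ConeSeparation.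

(** * The dual space as a module with a norm *)

Section Dual.
Variables (R : realType) (E : normedModType R).
Implicit Types (f : E -> R) (x y : E) (M : R).

Lemma is_dual_bounded f : is_dual f -> exists M, forall x, `|f x| <= M * `|x|.
Proof.
move=> [flin fcont].
have f0 : f 0 = 0 by have := flin 1 0 0; rewrite scaler0 addr0 mul1r; lra.
have fZ a x : f (a *: x) = a * f x by have := flin a x 0; rewrite !addr0 f0 addr0.
have /cvgrPdist_lt/(_ 1 ltr01) := fcont 0.
move=> /nbhs_ballP[d /= d0 fd]; exists (2 / d) => x.
have [->|x0] := eqVneq x 0; first by rewrite f0 !normr0 mulr0.
have nx0 : 0 < `|x| by rewrite normr_gt0.
have k0 : 0 < d / 2 / `|x| by rewrite !divr_gt0.
have /fd : ball (0 : E) d ((d / 2 / `|x|) *: x).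
  rewrite -ball_normE /= sub0r normrN normrZ gtr0_norm //.
  by rewrite divfK ?gt_eqF // ltr_pdivrMr //; lra.
rewrite /= f0 sub0r normrN fZ normrM gtr0_norm // => h.
rewrite -(ler_pM2l k0); apply: le_trans (ltW h) _.
by rewrite le_eqVlt; apply/orP; left; apply/eqP; field; rewrite !gt_eqF.
Qed.

(** A one-sided bound suffices, since the unit ball is symmetric. *)
Lemma bounded_is_dual f M :
  (forall a x y, f (a *: x + y) = a * f x + f y) ->
  (forall x, `|x| <= 1 -> f x <= M) -> is_dual f.
Proof.
move=> flin fM; split => // x.
have f0 : f 0 = 0 by have := flin 1 0 0; rewrite scaler0 addr0 mul1r; lra.
have fZ a y : f (a *: y) = a * f y by have := flin a y 0; rewrite !addr0 f0 addr0.
have M0 : 0 <= M by rewrite -f0; apply: fM; rewrite normr0 ler01.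
have fub y : f y <= M * `|y|.
  have [->|y0] := eqVneq y 0; first by rewrite f0 normr0 mulr0.
  have ny0 : 0 < `|y| by rewrite normr_gt0.
  have : f (`|y|^-1 *: y) <= M.
    by apply: fM; rewrite normrZ ger0_norm ?invr_ge0 // mulVf ?gt_eqF.
  by rewrite fZ mulrC ler_pdivrMr.
apply/cvgrPdist_lt => e e0.
have d0 : 0 < e / (M + 1) by rewrite divr_gt0 // ltr_wpDl.
apply/nbhs_ballP; exists (e / (M + 1)) => //= y; rewrite -ball_normE /= => xy.
have fB : f x - f y = f (x - y).
  by have := flin (-1) y x; rewrite scaleN1r mulN1r [- y + x]addrC => ->; rewrite addrC.
have xyM : M * `|x - y| < e.
  apply: (le_lt_trans (y := (M + 1) * `|x - y|)).
    by rewrite ler_wpM2r // lerDl.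
  by rewrite mulrC -ltr_pdivlMr // ltr_wpDl.
rewrite fB ltr_norml (le_lt_trans (fub _) xyM) andbT ltrNl.
have -> : - f (x - y) = f (- (x - y)) by rewrite -[in RHS]scaleN1r fZ mulN1r.
by apply: le_lt_trans (fub _) _; rewrite normrN.
Qed.

Lemma le_dnorm_ball f x : is_dual f -> `|x| <= 1 -> `|f x| <= dnorm f.
Proof.
move=> /is_dual_bounded[M fM] x1; apply: ub_le_sup; last by exists x.
exists (`|M|) => _ [y /= y1 <-]; rewrite (le_trans (fM y)) //.
rewrite (le_trans (ler_norm _)) // normrM normr_id.
by rewrite -[leRHS]mulr1 ler_wpM2l.
Qed.

Lemma dnorm_le f M : (forall x, `|x| <= 1 -> `|f x| <= M) -> dnorm f <= M.
Proof.
move=> fM; apply: ge_sup; first by exists `|f 0|, 0; rewrite //= normr0 ler01.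
by move=> _ [x /= x1 <-]; exact: fM.
Qed.

Lemma dnorm_ge0 f : is_dual f -> 0 <= dnorm f.
Proof.
move=> df; apply: le_trans (normr_ge0 (f 0)) (le_dnorm_ball _ _ df _).
by rewrite normr0 ler01.
Qed.

Definition dual_pred : {pred E -> R^o} := fun f => `[< is_dual (f : E -> R) >].

Lemma dual_submod_closed : submod_closed dual_pred.
Proof.
split.
  apply/asboolP; apply: (@bounded_is_dual _ 0); last by [].
  by move=> a x y; rewrite mulr0 addr0.
move=> a f g /asboolP fD /asboolP gD; apply/asboolP.
have [M fM] := is_dual_bounded _ fD; have [N gN] := is_dual_bounded _ gD.
apply: (@bounded_is_dual _ (`|a| * dnorm f + dnorm g)).
  move=> b x y; case: fD gD => [fl _] [gl _].
  by rewrite !fctE /= fl gl /GRing.scale /=; ring.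
move=> x x1; rewrite (le_trans (ler_norm _)) // (le_trans (ler_normD _ _)) //.
by rewrite lerD ?le_dnorm_ball // normrM ler_wpM2l ?le_dnorm_ball.
Qed.

HB.instance Definition _ := GRing.isSubmodClosed.Build R (E -> R^o) dual_pred
  dual_submod_closed.

Record dual := Dual { dual_fun :> E -> R^o; _ : dual_fun \in dual_pred }.
HB.instance Definition _ := [isSub for dual_fun].
HB.instance Definition _ := [Choice of dual by <:].
HB.instance Definition _ := [SubChoice_isSubLmodule of dual by <:].

End Dual.

Arguments dual {R} E.

(** * Separation of a convex set from a convex function *)

Section ConvexDuality.
Variables (R : realType) (V : lmodType R).

(** [linear_minorant] is applied to the cone generated by the points above [(u + w, r + g w - d)]
    with [(u, r)] in [C]. Over 0 one has [w = - u], where the last hypothesis gives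
    nonnegativity. *)
Lemma convex_duality (C : set (V * R)) (g : V -> R) (d : R) :
  C !=set0 ->
  (forall u r v s a b, C (u, r) -> C (v, s) -> 0 < a -> 0 < b -> a + b = 1 ->
    C (a *: u + b *: v, a * r + b * s)) ->
  (forall u v a b, 0 < a -> 0 < b -> a + b = 1 ->
    g (a *: u + b *: v) <= a * g u + b * g v) ->
  (forall u r, C (u, r) -> d <= r + g (- u)) ->
  exists f : V -> R, (forall a u v, f (a *: u + v) = a * f u + f v) /\
    forall u r w, C (u, r) -> d + f (u + w) <= r + g w.
Proof.
move=> [[u0 r0] C0] Cconv gconv Cd.
pose K : set (V * R) := [set p | exists (t : R) y r w, [/\ 0 < t, C (y, r),
  p.1 = t *: (y + w) & t * (r + g w - d) <= p.2]].
have [||||f [flin fK]] := @linear_minorant R V K.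
- move=> _ r1 _ r2 [t1 [y1 [s1 [w1 /= [t10 C1 -> le1]]]]]
    [t2 [y2 [s2 [w2 /= [t20 C2 -> le2]]]]].
  have T0 : 0 < t1 + t2 by rewrite addr_gt0.
  have TV : t1 + t2 != 0 by rewrite gt_eqF.
  have s0 : 0 < t1 / (t1 + t2) by rewrite divr_gt0.
  have s'0 : 0 < t2 / (t1 + t2) by rewrite divr_gt0.
  have s1E : t1 / (t1 + t2) + t2 / (t1 + t2) = 1 by rewrite -mulrDl divff.
  exists (t1 + t2), (t1 / (t1 + t2) *: y1 + t2 / (t1 + t2) *: y2),
    (t1 / (t1 + t2) * s1 + t2 / (t1 + t2) * s2),
    (t1 / (t1 + t2) *: w1 + t2 / (t1 + t2) *: w2); split => //=.
  + exact: Cconv.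
  + rewrite addrACA -!scalerDr [RHS]scalerDr !scalerA.
    by rewrite ![(t1 + t2) * _]mulrC !divfK.
  + apply: le_trans (lerD le1 le2).
    have := gconv w1 w2 _ _ s0 s'0 s1E; rewrite -(ler_pM2l T0).
    have -> : (t1 + t2) * (t1 / (t1 + t2) * g w1 + t2 / (t1 + t2) * g w2) =
      t1 * g w1 + t2 * g w2 by field.
    set G := g _; have -> : (t1 + t2) * (t1 / (t1 + t2) * s1 +
      t2 / (t1 + t2) * s2 + G - d) =
      t1 * s1 + t2 * s2 + (t1 + t2) * G - (t1 + t2) * d by field.
    by lra.
- move=> a _ r a0 [t [y [s [w /= [t0 Cy -> le1]]]]].
  exists (a * t), y, s, w; split; rewrite ?mulr_gt0 //= ?scalerA //.
  by rewrite -mulrA ler_pM2l.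
- move=> r [t [y [s [w /= [t0 Cy /esym/eqP + le1]]]]].
  rewrite scaler_eq0 gt_eqF //= addrC addr_eq0 => /eqP wE.
  apply: le_trans le1; rewrite mulr_ge0 ?(ltW t0) // subr_ge0 wE.
  exact: Cd.
- move=> v; exists (r0 + g (v - u0) - d), 1, u0, r0, (v - u0); split => //=.
    by rewrite scale1r addrC subrK.
  by rewrite mul1r.
exists f; split => // u r w Cu.
rewrite addrC -lerBrDr; apply: fK; exists 1, u, r, w; split => //=.
  by rewrite scale1r.
by rewrite mul1r.
Qed.

End ConvexDuality.

(** * The pairing and the scaled quadratic form *)

Section DualPairing.
Variables (R : realType) (E : normedModType R).
Implicit Types (f g : dual E) (x y : E) (u v : E * dual E) (a b l : R).

Definition dn f : R := dnorm (f : E -> R).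

Lemma dualP f : is_dual (f : E -> R).
Proof. by case: f => f /= /asboolP. Qed.

Lemma dual_subproof (h : E -> R) : is_dual h -> (h : E -> R^o) \in dual_pred R E.
Proof. by move=> ?; apply/asboolP. Qed.

Definition to_dual (h : E -> R) (dh : is_dual h) : dual E :=
  Dual _ _ _ (dual_subproof h dh).

Lemma dualZD f a x y : f (a *: x + y) = a * f x + f y.
Proof. by case: (dualP f). Qed.

Lemma dual0 f : f 0 = 0.
Proof. by have := dualZD f 1 0 0; rewrite scaler0 addr0 mul1r; lra. Qed.

Lemma dualD f x y : f (x + y) = f x + f y.
Proof. by rewrite -[x]scale1r dualZD mul1r scale1r. Qed.

Lemma dualZ f a x : f (a *: x) = a * f x.
Proof. by rewrite -[a *: x]addr0 dualZD dual0 addr0. Qed.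

Lemma dualN f x : f (- x) = - f x.
Proof. by rewrite -scaleN1r dualZ mulN1r. Qed.

Lemma dualB f x y : f (x - y) = f x - f y.
Proof. by rewrite dualD dualN. Qed.

Lemma dual_scaleE a f x : (a *: f) x = a * f x. Proof. by []. Qed.

Lemma dn_ge0 f : 0 <= dn f. Proof. exact: dnorm_ge0 (dualP f). Qed.

Lemma le_dn f x : `|f x| <= dn f * `|x|.
Proof.
have [->|x0] := eqVneq x 0; first by rewrite dual0 !normr0 mulr0.
have nx0 : 0 < `|x| by rewrite normr_gt0.
have := le_dnorm_ball _ _ f (`|x|^-1 *: x) (dualP f).
rewrite dualZ normrZ normrM ger0_norm ?invr_ge0 // mulVf ?gt_eqF // => /(_ (lexx _)).
by rewrite mulrC ler_pdivrMr.
Qed.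

Lemma dual_le f x : f x <= dn f * `|x|.
Proof. exact: le_trans (ler_norm _) (le_dn f x). Qed.

Lemma dual_ge f x : - (dn f * `|x|) <= f x.
Proof. by have := le_dn f x; rewrite ler_norml => /andP[]. Qed.

Lemma dnD f g : dn (f + g) <= dn f + dn g.
Proof.
apply: dnorm_le => x x1; apply: le_trans (ler_normD _ _) _.
by rewrite lerD // le_dnorm_ball //; exact: dualP.
Qed.

Lemma dnZ_le a f : dn (a *: f) <= `|a| * dn f.
Proof.
apply: dnorm_le => x x1; rewrite dual_scaleE normrM ler_wpM2l //.
by rewrite le_dnorm_ball //; exact: dualP.
Qed.

Lemma dnN f : dn (- f) = dn f.
Proof.
apply/eqP; rewrite eq_le; apply/andP; split.
  by have := dnZ_le (-1) f; rewrite scaleN1r normrN1 mul1r.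
by have := dnZ_le (-1) (- f); rewrite scaleN1r opprK normrN1 mul1r.
Qed.

Definition pair_q v : R := v.2 v.1.
Definition pair_g l v : R := l^-1 / 2 * `|v.1| ^+ 2 + l / 2 * dn v.2 ^+ 2.

Lemma young l a b : 0 < l -> a * b <= l^-1 / 2 * a ^+ 2 + l / 2 * b ^+ 2.
Proof.
move=> l0; rewrite -(ler_pM2l l0) -subr_ge0.
have -> : l * (l^-1 / 2 * a ^+ 2 + l / 2 * b ^+ 2) - l * (a * b) =
  2^-1 * (a - l * b) ^+ 2 by field; rewrite gt_eqF.
by rewrite mulr_ge0 // sqr_ge0.
Qed.

Lemma pair_g_ge0 l v : 0 < l -> 0 <= pair_g l v.
Proof.
move=> l0; rewrite /pair_g addr_ge0 // mulr_ge0 ?sqr_ge0 // divr_ge0 ?invr_ge0 //;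
exact: ltW.
Qed.

Lemma pair_gq_ge0 l v : 0 < l -> 0 <= pair_g l v + pair_q v.
Proof.
move=> l0; have := young l `|v.1| (dn v.2) l0; have := dual_ge v.2 v.1.
by rewrite /pair_g /pair_q; lra.
Qed.

Lemma pair_gN l v : pair_g l (- v) = pair_g l v.
Proof. by rewrite /pair_g /= normrN dnN. Qed.

Lemma pair_g_convex l u v a b : 0 < l -> 0 < a -> 0 < b -> a + b = 1 ->
  pair_g l (a *: u + b *: v) <= a * pair_g l u + b * pair_g l v.
Proof.
move=> l0 a0 b0 ab1.
have sq (p q c : R) : 0 <= c -> c <= a * p + b * q ->
    c ^+ 2 <= a * p ^+ 2 + b * q ^+ 2.
  move=> c0 h; apply: le_trans (_ : (a * p + b * q) ^+ 2 <= _).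
    by rewrite lerXn2r // nnegrE (le_trans c0).
  rewrite -subr_ge0.
  have -> : a * p ^+ 2 + b * q ^+ 2 - (a * p + b * q) ^+ 2 = a * b * (p - q) ^+ 2.
    by have -> : b = 1 - a by [lra]; ring.
  by rewrite mulr_ge0 ?sqr_ge0 // mulr_ge0 // ltW.
have h1 : `|(a *: u + b *: v).1| ^+ 2 <= a * `|u.1| ^+ 2 + b * `|v.1| ^+ 2.
  apply: sq => //; apply: le_trans (ler_normD _ _) _.
  by rewrite !normrZ !gtr0_norm.
have h2 : dn (a *: u + b *: v).2 ^+ 2 <= a * dn u.2 ^+ 2 + b * dn v.2 ^+ 2.
  apply: sq; first exact: dn_ge0.
  apply: le_trans (dnD _ _) _; rewrite lerD //.
    by apply: le_trans (dnZ_le _ _) _; rewrite gtr0_norm.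
  by apply: le_trans (dnZ_le _ _) _; rewrite gtr0_norm.
have c1 : 0 <= l^-1 / 2 by rewrite divr_ge0 // invr_ge0 ltW.
have c2 : 0 <= l / 2 by rewrite divr_ge0 // ltW.
have := ler_wpM2l c1 h1; have := ler_wpM2l c2 h2; rewrite /pair_g.
lra.
Qed.

Lemma pair_qB u v : pair_q (u - v) = pair_q u - (v.2 u.1 + u.2 v.1) + pair_q v.
Proof.
have -> : pair_q (u - v) = u.2 (u.1 - v.1) - v.2 (u.1 - v.1) by [].
by rewrite !dualB /pair_q; ring.
Qed.

End DualPairing.

Arguments dn {R E} f.
Arguments to_dual {R E h} dh.
Arguments pair_q {R E} v.
Arguments pair_g {R E} l v.

(** * Almost norming vectors *)

Section BoundedFunctional.
Variables (R : realType) (V : lmodType R) (N : V -> R) (c : V -> R) (M : R).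
Hypothesis N0 : forall v, 0 <= N v.
Hypothesis NZ : forall a v, N (a *: v) <= `|a| * N v.
Hypothesis cZ : forall a v, c (a *: v) = a * c v.
Hypothesis cM : forall v, N v <= 1 -> c v <= M.

(** [B] is the norm of [c]. In the last clause an almost norming unit vector is multiplied by [B],
    so that [c v] is close to [B ^+ 2], as quadratic estimates require. *)
Lemma functional_norm : exists B, [/\ 0 <= B, forall v, c v <= B * N v &
  forall e, 0 < e -> exists2 v, N v <= B & B ^+ 2 - e <= c v].
Proof.
have c0 : c 0 = 0 by rewrite -(scale0r 0) cZ mul0r.
have N00 : N 0 = 0.
  by apply/eqP; rewrite eq_le N0 andbT -(scale0r 0); have := NZ 0 0; rewrite normr0 mul0r.
pose A : set R := [set c v | v in [set v | N v <= 1]].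
have A0 : A 0 by exists 0; rewrite //= N00 ler01.
have hA : has_sup A.
  by split; [exists 0|exists M => _ [v /= v1 <-]; exact: cM].
have B0 : 0 <= sup A by apply: ub_le_sup A0; case: hA.
exists (sup A); split => // [v|e e0].
  have [Nv|Nv] := eqVneq (N v) 0.
    (* All multiples of [v] lie in the unit ball, so [c v > 0] would let [c] exceed its supremum
       there. *)
    rewrite Nv mulr0 leNgt; apply/negP => cv.
    have /ubP := (sup_upper_bound hA : ubound A (sup A)).
    have : A ((sup A + 1) / c v * c v).
      exists (((sup A + 1) / c v) *: v) => //=.
      by apply: le_trans (NZ _ _) _; rewrite Nv mulr0 ler01.
    by move=> /[swap] /[apply]; rewrite divfK ?gt_eqF //; lra.
  have Nv0 : 0 < N v by rewrite lt_neqAle eq_sym Nv N0.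
  rewrite -ler_pdivrMr // mulrC; apply: ub_le_sup; first by case: hA.
  exists ((N v)^-1 *: v) => //=; apply: le_trans (NZ _ _) _.
  by rewrite gtr0_norm ?invr_gt0 // mulVf.
have B1 : 0 < sup A + 1 by rewrite ltr_wpDl.
have e1 : 0 < e / (sup A + 1) by rewrite divr_gt0.
have [_ [v /= v1 <-] hv] := sup_adherent e1 hA.
exists (sup A *: v).
  by apply: le_trans (NZ _ _) _; rewrite ger0_norm // ler_piMr.
rewrite cZ; apply: le_trans (_ : sup A * (sup A - e / (sup A + 1)) <= _); last first.
  by rewrite ler_wpM2l // ltW.
rewrite mulrBr -expr2 lerD2l lerN2 mulrA ler_pdivrMr // mulrC ler_wpM2l ?ltW //.
by rewrite ltrDl.
Qed.

End BoundedFunctional.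

(** * The Fitzpatrick function and the change of scale *)

Section Scaling.
Variables (R : realType) (E : normedModType R).
Implicit Types (G : set (E * dual E)) (u v p : E * dual E) (a b l e : R).

Definition monotone_graph G := forall u v, G u -> G v -> 0 <= pair_q (u - v).

Definition quasidense_graph l G := forall v e, 0 < e ->
  exists2 p, G p & pair_g l (p - v) + pair_q (p - v) <= e.

Lemma monotone_translate G v : monotone_graph G -> monotone_graph [set p | G (p + v)].
Proof.
move=> mG u w /= Gu Gw; have := mG _ _ Gu Gw.
by rewrite opprD addrACA subrr addr0.
Qed.

Lemma quasidense_translate l G v :
  quasidense_graph l G -> quasidense_graph l [set p | G (p + v)].
Proof.
move=> qG w e e0; have [p Gp hp] := qG (w + v) e e0.
exists (p - v); first by rewrite /= subrK.
by have -> : p - v - w = p - (w + v) by rewrite opprD [- w - v]addrC addrA.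
Qed.

(* The epigraph of the Fitzpatrick function of [G]. *)
Definition fitzpatrick G : set ((E * dual E) * R) :=
  [set w : (E * dual E) * R | forall p, G p -> p.2 w.1.1 + w.1.2 p.1 - pair_q p <= w.2].

Lemma graph_fitzpatrick G p : monotone_graph G -> G p -> fitzpatrick G (p, pair_q p).
Proof. by move=> mG Gp s Gs /=; have := mG _ _ Gp Gs; rewrite pair_qB; lra. Qed.

Lemma fitzpatrick_convex G u r v s a b :
  fitzpatrick G (u, r) -> fitzpatrick G (v, s) -> 0 < a -> 0 < b -> a + b = 1 ->
  fitzpatrick G (a *: u + b *: v, a * r + b * s).
Proof.
move=> Fu Fv a0 b0 ab p Gp.
change (p.2 (a *: u.1 + b *: v.1) + (a * u.2 p.1 + b * v.2 p.1) - pair_q p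
  <= a * r + b * s); rewrite dualZD dualZ.
have := Fu _ Gp; have := Fv _ Gp; rewrite /= -(ler_pM2l b0) => hv.
rewrite -(ler_pM2l a0) => hu; apply: le_trans (lerD hu hv).
by have -> : b = 1 - a by [lra]; lra.
Qed.

(** The Fitzpatrick inequality at [p] reads [pair_q v - pair_q (p - v) <= r], and quasidensity at
    [v] makes [pair_q (p - v)] at most [e]. *)
Lemma pair_q_le_fitzpatrick G v r : quasidense_graph 1 G ->
  fitzpatrick G (v, r) -> pair_q v <= r.
Proof.
move=> qG Fv; apply/ler_addgt0Pr => e e0; have [p Gp] := qG v e e0.
have := pair_g_ge0 R E 1 (p - v) ltr01; have := Fv _ Gp.
by rewrite pair_qB /=; lra.
Qed.

(* If the infimum were positive, a separating functional [(a, b)] on [E * dual E] would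
   exist. Quasidensity at [(0, a + v)], with [v] almost norming [b], contradicts it. *)
Lemma fitzpatrick_inf G l e : 0 < l -> 0 < e ->
  monotone_graph G -> quasidense_graph 1 G ->
  exists v r, fitzpatrick G (v, r) /\ r + pair_g l v <= e.
Proof.
move=> l0 e0 mG qG; apply: contrapT => none.
have [p0 Gp0 _] := qG 0 1 ltr01.
have F0 := graph_fitzpatrick _ _ mG Gp0.
have [||u v a b|u r Fu|f [flin fF]] :=
    @convex_duality R (E * dual E)%type (fitzpatrick G) (pair_g l) e.
- by exists (p0, pair_q p0).
- by move=> u r v s a b; exact: fitzpatrick_convex.
- exact: pair_g_convex.
- rewrite pair_gN leNgt; apply/negP => h; apply: none; exists u, r.
  by split => //; exact: ltW.
have fD u v : f (u + v) = f u + f v by rewrite -[u]scale1r flin mul1r scale1r.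
have f0 : f 0 = 0 by have := fD 0 0; rewrite addr0; lra.
have fZ a u : f (a *: u) = a * f u by rewrite -[a *: u]addr0 flin f0 addr0.
have fub w : f w <= pair_q p0 + pair_g l w - e - f p0.
  by have := fF _ _ w F0; rewrite fD; lra.
have c1 : 0 < l^-1 / 2 by rewrite divr_gt0 ?invr_gt0.
have c2 : 0 < l / 2 by rewrite divr_gt0.
pose a x := f (x, 0 : dual E); pose b h := f (0 : E, h : dual E).
have fab w : f w = a w.1 + b w.2.
  rewrite /a /b -fD; congr f; case: w => w1 w2.
  by congr (_, _); rewrite /= ?addr0 ?add0r.
have dn00 : dn (0 : dual E) = 0.
  apply/eqP; rewrite eq_le dn_ge0 andbT -(scale0r 0).
  by have := dnZ_le R E 0 0; rewrite normr0 mul0r.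
have aZD s x y : a (s *: x + y) = s * a x + a y.
  rewrite /a -flin; congr f; congr (_, _).
  by rewrite /= scaler0 addr0.
have bZD s x y : b (s *: x + y) = s * b x + b y.
  rewrite /b -flin; congr f; congr (_, _).
  by rewrite /= scaler0 addr0.
have a0 : a 0 = 0 by exact: f0.
have b0 : b 0 = 0 by exact: f0.
have aZ s x : a (s *: x) = s * a x by rewrite -[s *: x]addr0 aZD a0 addr0.
have bZ s x : b (s *: x) = s * b x by rewrite -[s *: x]addr0 bZD b0 addr0.
have bD x y : b (x + y) = b x + b y by rewrite -[x]scale1r bZD mul1r scale1r.
have aM x : `|x| <= 1 -> a x <= pair_q p0 + l^-1 / 2 - e - f p0.
  move=> x1; apply: le_trans (fub (x, 0)) _; rewrite /pair_g /= dn00.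
  have : l^-1 / 2 * `|x| ^+ 2 <= l^-1 / 2 * 1.
    by rewrite ler_pM2l // expr_le1.
  by lra.
have bM h : dn h <= 1 -> b h <= pair_q p0 + l / 2 - e - f p0.
  move=> h1; apply: le_trans (fub (0, h)) _; rewrite /pair_g /= normr0.
  have : l / 2 * dn h ^+ 2 <= l / 2 * 1.
    by rewrite ler_pM2l // expr_le1 // dn_ge0.
  by lra.
pose ad := to_dual (bounded_is_dual R E a _ aZD aM).
have adE x : ad x = a x by [].
have nZ (s : R) (x : E) : `|s *: x| <= `|s| * `|x| by rewrite normrZ.
have [A [A0 aA Aa]] := functional_norm R E (fun x => `|x|) a _
  (@normr_ge0 _ _) nZ aZ aM.
have [B [B0 bB Bb]] := functional_norm R (dual E) dn b _
  (dn_ge0 R E) (dnZ_le R E) bZ bM.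
have adA : dn ad <= A.
  apply: dnorm_le => x x1; rewrite ler_norml; apply/andP; split.
    rewrite lerNl -[- _](dualN R E ad) adE (le_trans (aA _)) // normrN.
    by rewrite ler_piMr.
  by rewrite adE (le_trans (aA _)) // ler_piMr.
(* The tolerance [z] is spent once on [b v], once on quasidensity, [l] times on [a x] and [l^-1]
   times on [b v]; the total is [e / 2]. *)
pose k := 2 + l + l^-1.
have k0 : 0 < k by rewrite /k !addr_gt0 ?invr_gt0.
pose z := e / 2 / k.
have z0 : 0 < z by rewrite /z !divr_gt0.
have [v vB bv] := Bb _ z0; have [x xA ax] := Aa _ z0.
(* The shift by [ad] cancels [a s1]. The shift by [v] yields [b v], close to [B ^+ 2], which with
   the squares in [H2] absorbs the terms [B * |s1|] and [B * dn h]. *)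
have [[s1 s2] Gs H2] := qG (0, ad + v) _ z0.
have [h s2E] : exists h, s2 = h + (ad + v) by exists (s2 - (ad + v)); rewrite subrK.
subst s2; move: H2.
have -> : (s1, h + (ad + v)) - (0, ad + v) = (s1, h).
  by congr (_, _); rewrite /= ?subr0 // addrK.
(* This point nearly maximises [f w - pair_g l w], whose supremum is
   [l / 2 * A ^+ 2 + l^-1 / 2 * B ^+ 2]. *)
have := fF _ _ (l *: x, l^-1 *: v) (graph_fitzpatrick _ _ mG Gs).
have -> : pair_q (s1, h + (ad + v)) = h s1 + (a s1 + v s1) by [].
rewrite fD !fab /= aZ bZ !bD /pair_g /pair_q /= => H1; rewrite invr1 => H2.
have bh : - (B * dn h) <= b h.
  have := bB (- h); rewrite dnN -scaleN1r bZ; lra.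
have bad : - (B * A) <= b ad.
  have := bB (- ad); rewrite dnN -scaleN1r bZ => h1.
  have := ler_wpM2l B0 adA; lra.
have vs : v s1 <= B * `|s1|.
  by apply: le_trans (dual_le _ _ _ _) _; rewrite ler_wpM2r.
have AB := young R l B A l0.
have li0 : 0 < l^-1 by rewrite invr_gt0.
have lx : l^-1 / 2 * `|l *: x| ^+ 2 <= l / 2 * A ^+ 2.
  rewrite normrZ gtr0_norm // exprMn.
  have -> : l^-1 / 2 * (l ^+ 2 * `|x| ^+ 2) = l / 2 * `|x| ^+ 2.
    by field; rewrite gt_eqF.
  by rewrite ler_pM2l // lerXn2r // nnegrE.
have lv : l / 2 * dn (l^-1 *: v) ^+ 2 <= l^-1 / 2 * B ^+ 2.
  apply: le_trans (_ : l / 2 * (l^-1 * B) ^+ 2 <= _); last first.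
    by rewrite le_eqVlt; apply/orP; left; apply/eqP; field; rewrite gt_eqF.
  rewrite ler_pM2l // lerXn2r ?nnegrE ?dn_ge0 ?mulr_ge0 ?(ltW li0) //.
  apply: le_trans (dnZ_le _ _ _ _) _; rewrite gtr0_norm //.
  by rewrite ler_pM2l.
have lax := ler_wpM2l (ltW l0) ax.
have lbv := ler_wpM2l (ltW li0) bv.
have y1 := sqr_ge0 (B - `|s1|); have y2 := sqr_ge0 (B - dn h).
have zk : z * 2 + z * l + z * l^-1 = e / 2.
  by rewrite -!mulrDr /z divfK // gt_eqF.
move: lbv lax zk bad; rewrite !mulrBr => lbv lax zk bad; lra.
Qed.

(* Quasidensity at [y] replaces the point [(y, r)] of the epigraph by a nearby point
   of [G]. *)
Lemma scaled_quasidense0 G l e : 0 < l -> 0 < e ->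
  monotone_graph G -> quasidense_graph 1 G ->
  exists2 p, G p & pair_g l p + pair_q p <= e.
Proof.
move=> l0 e0 mG qG.
have [p0 Gp0 _] := qG 0 1 ltr01.
have li0 : 0 < l^-1 by rewrite invr_gt0.
have ll : l * l^-1 = 1 by rewrite divff // gt_eqF.
(* A priori bound for the point [(y, r)] found below: the Fitzpatrick inequality at [p0] bounds [r]
   below by an affine function of the norms of [y], so both scaled squares in [pair_g l y] are
   controlled by [c], and both norms by [M]. *)
pose c := 1 + `|pair_q p0| + 2 * l * dn p0.2 ^+ 2 + 2 * l^-1 * `|p0.1| ^+ 2.
have c0 : 0 <= c.
  by rewrite /c !addr_ge0 // mulr_ge0 ?sqr_ge0 // mulr_ge0 // ltW.
pose M := 1 + 4 * l * c + 4 * l^-1 * c.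
have lc0 : 0 <= l * c by rewrite mulr_ge0 // ltW.
have lic0 : 0 <= l^-1 * c by rewrite mulr_ge0 // ltW.
have M0 : 0 <= M by rewrite /M; lra.
pose D := 1 + 2 * M + (l^-1 + l) * (2 * M + 1).
have w0 : 0 <= (l^-1 + l) * (2 * M + 1) by apply: mulr_ge0; lra.
have D0 : 0 < D.
  by rewrite /D; lra.
(* [n] will bound both components of [p - y], and [n * D] the resulting value of
   [pair_g l p + pair_q p]. *)
pose n := Num.min 1 (e / D).
have n0 : 0 < n by rewrite lt_min ltr01 divr_gt0.
have n1 : n <= 1 by rewrite ge_min lexx.
have nD : n * D <= e by rewrite -ler_pdivlMr // ge_min lexx orbT.
have nn : n ^+ 2 <= n by rewrite expr2 ler_piMl // ltW.
have n20 : 0 < n ^+ 2 / 4 by rewrite divr_gt0 // exprn_gt0.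
have [y [r [Fy gy]]] := fitzpatrick_inf G l _ l0 n20 mG qG.
have qy := pair_q_le_fitzpatrick _ _ _ qG Fy.
have y1M : `|y.1| <= M /\ dn y.2 <= M.
  have := Fy _ Gp0; rewrite /= => F0; move: gy; rewrite /pair_g => gy.
  have h1 := dual_ge R E p0.2 y.1; have h2 := dual_ge R E y.2 p0.1.
  have h3 := young R l (`|y.1| / 2) (2 * dn p0.2) l0.
  have h4 := young R l (2 * `|p0.1|) (dn y.2 / 2) l0.
  have h5 := ler_norm (pair_q p0).
  have h6 := sqr_ge0 (`|y.1| - 1); have h7 := sqr_ge0 (dn y.2 - 1).
  have k1 : 0 <= l^-1 * `|y.1| ^+ 2 by rewrite mulr_ge0 ?sqr_ge0 // ltW.
  have k2 : 0 <= l * dn y.2 ^+ 2 by rewrite mulr_ge0 ?sqr_ge0 // ltW.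
  have b1 : l^-1 * `|y.1| ^+ 2 <= 4 * c by rewrite /c; lra.
  have b2 : l * dn y.2 ^+ 2 <= 4 * c by rewrite /c; lra.
  have := ler_wpM2l (ltW l0) b1; have := ler_wpM2l (ltW li0) b2.
  rewrite !mulrA ll mulVf ?gt_eqF // !mul1r => b4 b3.
  by rewrite /M; split; lra.
have [p Gp hp] := qG y _ n20; exists p => //.
(* [y] is almost monotonically related to [G]. Together with [hp] this leaves
   [pair_g 1 (p - y) <= n ^+ 2 / 2]. *)
have qpy : - (n ^+ 2 / 4) <= pair_q (p - y).
  have := Fy _ Gp; have := pair_gq_ge0 R E l y l0; rewrite pair_qB /=; lra.
have [d pE] : exists d, p = y + d by exists (p - y); rewrite addrC subrK.
move: hp qpy; rewrite pE [y + d]addrC addrK => hd qd.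
have gd := pair_g_ge0 R E 1 d ltr01.
have [d1 d2] : `|d.1| <= n /\ dn d.2 <= n.
  move: hd gd; rewrite /pair_g invr1 => hd gd.
  have s1 := sqr_ge0 `|d.1|; have s2 := sqr_ge0 (dn d.2).
  by split; rewrite -ler_sqr ?nnegrE ?normr_ge0 ?dn_ge0 ?(ltW n0) //; lra.
case: y1M => y1M y2M.
have -> : pair_q (d + y) = pair_q y + pair_q d + (d.2 y.1 + y.2 d.1).
  have -> : pair_q (d + y) = d.2 (d.1 + y.1) + y.2 (d.1 + y.1) by [].
  by rewrite !dualD /pair_q; ring.
have i1 : d.2 y.1 <= n * M.
  by apply: le_trans (dual_le _ _ _ _) _; rewrite ler_pM // dn_ge0.
have i2 : y.2 d.1 <= n * M.
  by apply: le_trans (dual_le _ _ _ _) _; rewrite mulrC ler_pM // dn_ge0.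
have sq a b : 0 <= a -> a <= b + n -> 0 <= b -> b <= M ->
    a ^+ 2 <= b ^+ 2 + (2 * M + 1) * n.
  move=> a0 ab b0 bM; apply: le_trans (_ : (b + n) ^+ 2 <= _).
    by rewrite lerXn2r // nnegrE addr_ge0 // ltW.
  have := ler_wpM2r (ltW n0) bM; lra.
have j1 : `|(d + y).1| ^+ 2 <= `|y.1| ^+ 2 + (2 * M + 1) * n.
  apply: sq => //; apply: le_trans (ler_normD d.1 y.1) _.
  by rewrite addrC lerD2l.
have j2 : dn (d + y).2 ^+ 2 <= dn y.2 ^+ 2 + (2 * M + 1) * n.
  apply: sq => //; rewrite ?dn_ge0 //; apply: le_trans (dnD _ _ d.2 y.2) _.
  by rewrite addrC lerD2l.
have := ler_wpM2l (ltW li0) j1; have := ler_wpM2l (ltW l0) j2.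
move: gy hd; rewrite {1}/pair_g => gy hd m1 m2; rewrite /pair_g.
move: nD; rewrite /D => nD.
have wn0 := mulr_ge0 w0 (ltW n0).
lra.
Qed.

Lemma scaled_quasidense G l : 0 < l ->
  monotone_graph G -> quasidense_graph 1 G -> quasidense_graph l G.
Proof.
move=> l0 mG qG v e e0.
have [p Gp hp] := scaled_quasidense0 _ l e l0 e0
  (monotone_translate _ v mG) (quasidense_translate _ _ v qG).
by exists (p + v) => //; rewrite addrK.
Qed.

End Scaling.

Arguments monotone_graph {R E} G.
Arguments quasidense_graph {R E} l G.
Arguments fitzpatrick {R E} G _.

(** * Approximate resolvents and local monotonicity at the origin *)

Section LocalMonotonicity.
Variables (R : realType) (E : normedModType R).
Variables (G : set (E * dual E)) (U : set E) (x0 : E).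
Hypothesis mG : monotone_graph G.
Hypothesis qG : forall l : R, 0 < l -> quasidense_graph l G.
Hypotheses (Uopen : open U) (Uconv : Defs.convex_set U) (U0 : U 0) (Ux0 : U x0).
Hypothesis Gx0 : exists h, G (x0, h).
Hypothesis Gloc : forall p, G p -> U p.1 -> 0 <= pair_q p.
Implicit Types (p s t : E * dual E) (y : E) (a b l e r : R).

(** Monotonicity bounds [s.2 (s.1 - y)] below by [s.2 (t.1 - y)] plus a term in [t.2], and Young's
    inequality at scale [l] absorbs the former into the square of [dn s.2]. For small [l], [s.1] is
    hardly farther from [y] than [t.1]. *)
Lemma resolvent_bound l e y s t : 0 < l -> G s -> G t ->
  pair_g l (s - (y, 0)) + pair_q (s - (y, 0)) <= e ->
  `|s.1 - y| ^+ 2 <= `|t.1 - y| ^+ 2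
     + 2 * l * (e + (`|s.1 - y| + `|t.1 - y|) * dn t.2).
Proof.
move=> l0 Gs Gt.
have -> : s - (y, 0) = (s.1 - y, s.2) by case: (s) => ? ?; congr (_, _); rewrite /= subr0.
rewrite /pair_g /pair_q /= => hs.
have := mG _ _ Gs Gt.
have -> : pair_q (s - t) = s.2 (s.1 - t.1) - t.2 (s.1 - t.1) by [].
have {1}-> : s.1 - t.1 = (s.1 - y) - (t.1 - y) by rewrite opprB addrA subrK.
rewrite dualB => st.
have h1 := dual_ge R E t.2 (s.1 - t.1).
have h2 := dual_ge R E s.2 (t.1 - y).
have h3 := young R l `|t.1 - y| (dn s.2) l0.
have h4 : `|s.1 - t.1| <= `|s.1 - y| + `|t.1 - y|.
  by have := ler_distD y s.1 t.1; rewrite [`|y - _|]distrC.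
have := ler_wpM2l (dn_ge0 R E t.2) h4 => h5.
have : l^-1 / 2 * `|s.1 - y| ^+ 2 <= l^-1 / 2 * `|t.1 - y| ^+ 2 +
  (e + (`|s.1 - y| + `|t.1 - y|) * dn t.2) by lra.
rewrite -(ler_pM2l (_ : 0 < 2 * l)) ?mulr_gt0 // mulrDr !mulrA.
have -> : 2 * l / l / 2 = 1 :> R by field; rewrite gt_eqF.
by rewrite !mul1r.
Qed.

(** If [a > b + n], then [n * (a + b) < a ^+ 2 - b ^+ 2], while [l0] ensures [2 * l * M <= n / 2]
    and [2 * l <= n ^+ 2 / 2]; so one threshold serves all [a] and [b]. *)
Lemma small_parameter (M n : R) : 0 <= M -> 0 < n -> exists2 l0, 0 < l0 &
  forall l a b e, 0 < l -> l <= l0 -> 0 <= a -> 0 <= b -> e <= 1 ->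
    a ^+ 2 <= b ^+ 2 + 2 * l * (e + (a + b) * M) -> a <= b + n.
Proof.
move=> M0 n0; have M1 : 0 < 4 * (M + 1) by rewrite mulr_gt0 // ltr_wpDl.
exists (Num.min (n / (4 * (M + 1))) (n ^+ 2 / 4)).
  by rewrite lt_min !divr_gt0 // exprn_gt0.
move=> l a b e l0; rewrite le_min ler_pdivlMr // => /andP[lM ln] a0 b0 e1 h.
rewrite leNgt; apply/negP => ab.
have l1 : l * e <= l by rewrite ler_piMr // ltW.
have lM' : 2 * l * M <= n / 2 by lra.
have ab0 : 0 <= a + b by lra.
have := ler_wpM2r ab0 lM'.
have : n * (a + b) < (a - b) * (a + b) by rewrite ltr_pM2r; lra.
have : n * n < n * (a + b) by rewrite ltr_pM2l //; lra.
move: h ln; rewrite !expr2; lra.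
Qed.

(* If [0] were not in the closure of the domain, let [y] lie on the segment from [0] to
   [x0], just outside that closure but close to it. As [l] tends to [0], the approximate
   resolvents [s] at [y] stay in [U] while [pair_q s] tends to [-oo]. *)
Lemma zero_in_closure_dom k : 0 < k -> exists2 p, G p & `|p.1| < k.
Proof.
move=> k0; apply: contrapT => none.
have {}none p : G p -> k <= `|p.1|.
  by move=> Gp; rewrite leNgt; apply/negP => pk; apply: none; exists p.
(* Parameters of the points on the ray through [x0] in the closure of the domain; [i] is where this
   closure is first met from 0. *)
pose A : set R := [set a | 0 <= a /\ forall e, 0 < e ->
  exists2 p, G p & `|p.1 - a *: x0| < e].
have [h0 Gh0] := Gx0.
have A1 : A 1.
  split=> // e e0; exists (x0, h0) => //.
  by rewrite scale1r subrr normr0.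
have hA : has_inf A by split; [exists 1|exists 0 => a []].
set i := inf A.
have i1 : i <= 1 by apply: ge_inf A1; case: hA.
have X0 : 0 < `|x0| by apply: lt_le_trans k0 (none _ Gh0).
have i0 : 0 < i.
  apply: lt_le_trans (_ : k / (2 * `|x0|) <= _).
    by rewrite divr_gt0 // mulr_gt0.
  apply: lb_le_inf; first by exists 1.
  move=> a [a0 /(_ (k / 2))]; rewrite divr_gt0 // => /(_ isT)[p Gp pa].
  rewrite ler_pdivrMr ?mulr_gt0 //.
  have := ler_normD (p.1 - a *: x0) (a *: x0); rewrite subrK normrZ ger0_norm //.
  have := none _ Gp; lra.
have Uy : U (i *: x0).
  by have := Uconv _ _ i Ux0 U0 (ltW i0) i1; rewrite scaler0 addr0.
have /nbhs_ballP[rho /= rho0 Urho] := open_nbhs_nbhs (conj Uopen Uy).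
pose d := Num.min (i / 2) (rho / 8 / `|x0|).
have d0 : 0 < d by rewrite lt_min !divr_gt0.
have di : d < i by apply: le_lt_trans (_ : i / 2 < _); [rewrite ge_min lexx|lra].
have dX : d * `|x0| <= rho / 8 by rewrite -ler_pdivlMr // ge_min lexx orbT.
pose y := (i - d) *: x0.
(* Since [i - d] is below the infimum, [y] has positive distance from the domain. *)
have [dist dist0 ydist] : exists2 r, 0 < r & forall p, G p -> r <= `|p.1 - y|.
  apply: contrapT => nd; suff : A (i - d).
    by move=> /(ge_inf (proj2 hA)); rewrite -/i; lra.
  split=> [|e e0]; first by lra.
  apply: contrapT => ne; apply: nd; exists e => // p Gp.
  by rewrite leNgt; apply/negP => pe; apply: ne; exists p.
(* With [c <= dist / 2], replacing [i *: x0] by [t.1] costs at most a quarter of the gain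
   [l^-1 / 2 * dist ^+ 2]. *)
pose c := Num.min (dist / 2) (rho / 8).
have c0 : 0 < c by rewrite lt_min !divr_gt0.
have cdist : c <= dist / 2 by rewrite ge_min lexx.
have crho : c <= rho / 8 by rewrite ge_min lexx orbT.
have [t Gt tc] : exists2 t, G t & `|t.1 - i *: x0| < c.
  have cX : 0 < c / 2 / `|x0| by rewrite !divr_gt0.
  have [a Aa ai] := inf_adherent cX hA.
  have ia : i <= a by apply: ge_inf Aa; case: hA.
  have c20 : 0 < c / 2 by rewrite divr_gt0.
  case: Aa => _ /(_ _ c20)[t Gt ta]; exists t => //.
  have -> : t.1 - i *: x0 = (t.1 - a *: x0) + (a - i) *: x0.
    by rewrite scalerBl addrA subrK.
  apply: le_lt_trans (ler_normD _ _) _.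
  have : (a - i) * `|x0| < c / 2 by rewrite -ltr_pdivlMr // ltrBlDl.
  by rewrite normrZ ger0_norm ?subr_ge0 //; lra.
have yE : i *: x0 - y = d *: x0 by rewrite /y -scalerBl opprB addrC subrK.
have ny : `|i *: x0 - y| = d * `|x0| by rewrite yE normrZ gtr0_norm.
have ty : `|t.1 - y| <= c + rho / 8.
  by have := ler_distD (i *: x0) t.1 y; rewrite ny; lra.
have rho8 : 0 < rho / 8 by rewrite divr_gt0.
have [l0 l00 hl0] := small_parameter _ _ (dn_ge0 R E t.2) rho8.
pose T := (2 * (c + rho / 8) + rho / 8) * dn t.2.
have T0 : 0 <= T by rewrite mulr_ge0 ?dn_ge0 //; lra.
(* The second bound makes that gain outweigh [T], which dominates the contribution of [t.2] on
   [s.1 - t.1]. *)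
pose l := Num.min l0 (dist ^+ 2 / (4 * (T + 1))).
have T1 : 0 < 4 * (T + 1) by lra.
have lp : 0 < l by rewrite lt_min l00 divr_gt0 // exprn_gt0.
have ll0 : l <= l0 by rewrite ge_min lexx.
have lT : 4 * (T + 1) <= l^-1 * dist ^+ 2.
  rewrite [leRHS]mulrC ler_pdivlMr // [leLHS]mulrC -ler_pdivlMr //.
  by rewrite ge_min lexx orbT.
have [s Gs hs] := qG _ lp (y, 0) 1 ltr01.
have sty := hl0 _ _ _ _ lp ll0 (normr_ge0 _) (normr_ge0 _) (lexx 1)
  (resolvent_bound _ _ _ _ _ lp Gs Gt hs).
move: hs.
have -> : s - (y, 0) = (s.1 - y, s.2) by case: (s) => ? ?; congr (_, _); rewrite /= subr0.
rewrite /pair_g /pair_q /= => hs.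
have sU : 0 <= pair_q s.
  apply: Gloc => //; apply: Urho; rewrite -ball_normE /= distrC.
  have := ler_distD y s.1 (i *: x0); rewrite [`|y - _|]distrC ny; lra.
have sd := ydist _ Gs.
have sd2 : dist ^+ 2 <= `|s.1 - y| ^+ 2 by rewrite lerXn2r // ?nnegrE ?(ltW dist0).
have li0 : 0 < l^-1 by rewrite invr_gt0.
have lsd := ler_wpM2l (ltW li0) sd2.
have st : - T <= s.2 (s.1 - t.1).
  have := mG _ _ Gs Gt.
  have -> : pair_q (s - t) = s.2 (s.1 - t.1) - t.2 (s.1 - t.1) by [].
  have := dual_ge R E t.2 (s.1 - t.1).
  have : `|s.1 - t.1| <= 2 * (c + rho / 8) + rho / 8.
    by have := ler_distD y s.1 t.1; rewrite [`|y - _|]distrC; lra.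
  move=> /(ler_wpM2r (dn_ge0 R E t.2)); rewrite -/T; lra.
(* [d *: x0] is [i *: x0 - y], and [i *: x0] is close to [t.1]; [s.2] is at most [T] on [t.1 - s.1]
   and very negative on [s.1 - y]. *)
have sx0 : s.2 x0 <= 0.
  rewrite -(pmulr_rle0 _ d0) -dualZ -yE.
  rewrite !dualB.
  have := dual_ge R E s.2 (t.1 - i *: x0); rewrite dualB.
  have := young R l c (dn s.2) lp.
  have := ler_wpM2r (dn_ge0 R E s.2) (ltW tc).
  have : c ^+ 2 <= (dist / 2) ^+ 2 by rewrite lerXn2r // nnegrE; lra.
  move=> /(ler_wpM2l (ltW li0)).
  have := ler_wpM2l (ltW li0) sd2.
  move: st hs; rewrite !dualB; lra.
have : pair_q s = s.2 (s.1 - y) + (i - d) * s.2 x0.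
  by rewrite -dualZ -dualD subrK.
have : (i - d) * s.2 x0 <= 0 by rewrite mulr_ge0_le0 //; lra.
have : 0 <= l / 2 * dn s.2 ^+ 2 by rewrite mulr_ge0 ?sqr_ge0 // divr_ge0 // ltW.
lra.
Qed.

(** [l] is chosen only to keep the resolvent at 0 inside [U]; the closeness to the origin comes from
    the tolerance [n], because [pair_q s >= 0] leaves [pair_g l s <= n]. *)
Lemma graph_near_zero e : 0 < e -> exists2 p, G p & `|p.1| < e /\ dn p.2 < e.
Proof.
move=> e0.
have /nbhs_ballP[rho /= rho0 Urho] := open_nbhs_nbhs (conj Uopen U0).
have rho2 : 0 < rho / 2 by rewrite divr_gt0.
have [t Gt trho] := zero_in_closure_dom _ rho2.
have [l l0 hl] := small_parameter _ _ (dn_ge0 R E t.2) rho2.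
have li0 : 0 < l^-1 by rewrite invr_gt0.
have ll0 : 0 < 4 * (l + l^-1) by rewrite mulr_gt0 // addr_gt0.
pose n := Num.min 1 (e ^+ 2 / (4 * (l + l^-1))).
have n0 : 0 < n by rewrite lt_min ltr01 divr_gt0 // exprn_gt0.
have n1 : n <= 1 by rewrite ge_min lexx.
have ne : n * (4 * (l + l^-1)) <= e ^+ 2.
  by rewrite -ler_pdivlMr // ge_min lexx orbT.
have [s Gs hs] := qG _ l0 (0, 0) _ n0; exists s => //.
have := hl _ _ _ _ l0 (lexx l) (normr_ge0 _) (normr_ge0 _) n1
  (resolvent_bound _ _ _ _ _ l0 Gs Gt hs).
rewrite !subr0 => st.
have : 0 <= pair_q s.
  by apply: Gloc => //; apply: Urho; rewrite -ball_normE /= sub0r normrN; lra.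
move: hs; have -> : s - (0, 0) = s by exact: subr0.
rewrite /pair_g => hs qs.
have k1 : 0 <= l^-1 * `|s.1| ^+ 2 by rewrite mulr_ge0 ?sqr_ge0 // ltW.
have k2 : 0 <= l * dn s.2 ^+ 2 by rewrite mulr_ge0 ?sqr_ge0 // ltW.
have b1 : l^-1 * `|s.1| ^+ 2 <= 2 * n by lra.
have b2 : l * dn s.2 ^+ 2 <= 2 * n by lra.
have := ler_wpM2l (ltW l0) b1; have := ler_wpM2l (ltW li0) b2.
rewrite !mulrA divff ?mulVf ?gt_eqF // !mul1r => b4 b3.
have p1 := mulr_gt0 l0 n0; have p2 := mulr_gt0 li0 n0.
by split; rewrite -ltr_sqr ?nnegrE ?normr_ge0 ?dn_ge0 ?(ltW e0) //; lra.
Qed.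

End LocalMonotonicity.

(** * Return to multifunctions *)

Section Multifunction.
Variables (R : realType) (E : normedModType R) (S : E -> set (E -> R)).
Hypotheses (SE : multifunction S) (Sclosed : closed_mf S).
Hypotheses (Smono : monotone_mf S) (Sqd : quasidense S).

Let SG : set (E * dual E) := [set p : E * dual E | S p.1 p.2].

Let SG_monotone : monotone_graph SG.
Proof. by move=> u v Su Sv; exact: Smono Su Sv. Qed.

Let SG_quasidense : quasidense_graph 1 SG.
Proof.
move=> v e e0; have := Sqd v.1 v.2 (dualP _ _ v.2).
have e0E : (0 < e%:E)%E by rewrite lte_fin.
move=> /le_lt_trans/(_ e0E)/ereal_inf_lt[_ [s [ss [Ss ->]]]].
rewrite lte_fin => /ltW h; have dss := SE.2 _ _ Ss.
exists (s, to_dual dss) => //.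
by rewrite /pair_g invr1 div1r.
Qed.

Lemma multifunction_FPV : type_FPV S.
Proof.
split=> // U Uopen Uconv [x0 [Ux0 [h0 Sh0]]] w ws Uw dws Sloc.
(* Translation by [W] moves the given point to the origin, and closedness asks only for graph points
   near [W]. *)
pose W : E * dual E := (w, to_dual dws).
apply: (Sclosed _ _ dws) => e e0.
have dh0 := SE.2 _ _ Sh0.
have [||||||||p Gp [p1 p2]] := @graph_near_zero R E [set p | SG (p + W)]
  [set x | U (x + w)] (x0 - w) _ _ _ _ _ _ _ _ e e0.
- exact: monotone_translate.
- move=> l l0; apply: quasidense_translate.
  exact: scaled_quasidense.
- apply: open_comp Uopen => x _; apply: cvgD; [exact: cvg_id|exact: cvg_cst].
- move=> x y a Ux Uy a0 a1 /=.
  have -> : a *: x + (1 - a) *: y + w = a *: (x + w) + (1 - a) *: (y + w).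
    by rewrite !scalerDr [RHS]addrACA -scalerDl [a + _]addrC subrK scale1r.
  exact: Uconv.
- by rewrite /= add0r.
- by rewrite /= subrK.
- exists (to_dual dh0 - to_dual dws); rewrite /SG /=.
  by rewrite !subrK.
- move=> p Gp Up; have := Sloc _ _ Gp Up.
  have -> : (p + W).1 - w = p.1 by rewrite /= addrK.
  have -> : (p + W).2 p.1 = p.2 p.1 + ws p.1 by [].
  by rewrite addrK.
exists (p + W).1, (p + W).2; split => //.
have -> : (p + W).1 - w = p.1 by rewrite /= addrK.
split=> //; suff -> : (fun y => (p + W).2 y - ws y) = p.2 by [].
apply/funext => y.
have -> : (p + W).2 y = p.2 y + ws y by [].
by rewrite addrK.
Qed.

End Multifunction.

Theorem theorem5p2 (R : realType) (E : completeNormedModType R)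
  (S : E -> set (E -> R)) :
  (exists x : E, x != 0) ->
  multifunction S -> closed_mf S -> monotone_mf S -> quasidense S ->
  maximally_monotone S /\ type_FPV S.

Proof.
move=> _ SE Sclosed Smono Sqd.
have FPV := multifunction_FPV _ _ _ SE Sclosed Smono Sqd.
split=> //; split=> // w ws dws Sw.
case: FPV => _ /(_ setT openT); apply => //.
  by have [[[x xs] Sx] _] := SE; exists x; split => //; exists xs.
by move=> s ss Ss _; exact: Sw.
Qed.
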